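(* Let $\mathcal{V}\subseteq\mathbb{C}^N$ be a set of complex nodal voltages, let $\mathcal{S}\subseteq\mathbb{C}^N$ be a set of nodal power injections, and let $\partial\mathcal{V}$ denote the topological boundary of $\mathcal{V}$ in $\mathbb{C}^N$. Assume that (1) $\mathcal{V}$ is bounded, open and non-singular (i.e. the load-flow Jacobian $\mathbf{J}_{\mathbf{F}}(\mathbf{v})$ is non-singular for every $\mathbf{v}\in\mathcal{V}$); (2) $\mathcal{S}$ is connected; (3) $\mathbf{F}(\mathcal{V})\cap\mathcal{S}$ is not empty; (4) $\mathbf{F}(\partial\mathcal{V})\cap\mathcal{S}$ is empty. Then, for every $\mathbf{s}\in\mathcal{S}$, there exists $\mathbf{v}\in\mathcal{V}$ such that $\mathbf{F}(\mathbf{v})=\mathbf{s}$.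
   Context: Grid model. A single-phase grid has one slack bus (index $0$) with fixed complex voltage $v_0\in\mathbb{C}$ and $N$ $PQ$ buses (indices $1,\dots,N$). The $(N+1)\times(N+1)$ complex nodal admittance matrix is partitioned as $\mathbf{Y}=\begin{bmatrix}\mathbf{Y}_{00}&\mathbf{Y}_{0L}\\ \mathbf{Y}_{L0}&\mathbf{Y}_{LL}\end{bmatrix}$, where the $N\times N$ matrix $\mathbf{Y}_{LL}$ is invertible. Put $\mathbf{w}=-\mathbf{Y}_{LL}^{-1}\mathbf{Y}_{L0}v_0\in\mathbb{C}^N$. The load-flow function $\mathbf{F}:\mathbb{C}^N\to\mathbb{C}^N$, which maps a vector of complex nodal voltages $\mathbf{v}=(v_1,\dots,v_N)^T$ to the vector of complex nodal power injections $\mathbf{s}=(s_1,\dots,s_N)^T$, is $$\mathbf{F}(\mathbf{v})=\mathrm{diag}(\mathbf{v})\,\overline{\mathbf{Y}}_{LL}(\overline{\mathbf{v}}-\overline{\mathbf{w}}),$$ where the bar denotes (entrywise) complex conjugation. $\mathbf{J}_{\mathbf{F}}(\mathbf{v})$ denotes the Jacobian of $\mathbf{F}$ at $\mathbf{v}$, where $\mathbf{F}$ is viewed in rectangular coordinates as a continuously differentiable map $\mathbb{R}^{2N}\to\mathbb{R}^{2N}$ of $(\mathrm{Re}(\mathbf{v}),\mathrm{Im}(\mathbf{v}))$. A set $\mathcal{S}$ is connected if $\mathcal{S}$ itself and the empty set are the only subsets of $\mathcal{S}$ that are both closed and open in $\mathcal{S}$. *)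

(* Defs.v *)
From HB Require Import structures.
From mathcomp Require Import all_boot all_order all_algebra.
From mathcomp Require Import complex.
From mathcomp Require Import all_classical all_reals all_analysis.

Set Implicit Arguments.
Unset Strict Implicit.
Unset Printing Implicit Defensive.

Import Order.TTheory GRing.Theory Num.Theory.
Import numFieldNormedType.Exports.

Local Open Scope classical_set_scope.
Local Open Scope ring_scope.

Section ComplexTopology.
Variable R : realType.

(* R[i] carries no topology in the library; it receives the one induced by the
   complex modulus, from its regular module.  The library's matrix instances
   then equip 'cV[R[i]]_N with the sup norm of the moduli of the entries. *)
HB.instance Definition _ := NormedModule.copy R[i] R[i]^o.

End ComplexTopology.

Definition boundary (T : topologicalType) (A : set T) : set T :=
  closure A `\` interior A.

Section LoadFlow.
Variables (R : realType) (N : nat).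

Definition conj_mx m n (A : 'M[R[i]]_(m, n)) : 'M[R[i]]_(m, n) :=
  map_mx (@conjc R) A.

(* Index 0 is the slack bus: the blocks of Y are
     ulsubmx Y = Y_00, ursubmx Y = Y_0L, dlsubmx Y = Y_L0, drsubmx Y = Y_LL. *)
Implicit Types (Y : 'M[R[i]]_(1 + N)) (v : 'cV[R[i]]_N).

Definition zero_load_voltage Y (v0 : R[i]) : 'cV[R[i]]_N :=
  - (invmx (drsubmx Y) *m dlsubmx Y *m v0%:M).

Definition load_flow Y (v0 : R[i]) v : 'cV[R[i]]_N :=
  diag_mx v^T *m conj_mx (drsubmx Y)
    *m (conj_mx v - conj_mx (zero_load_voltage Y v0)).

(* Rectangular coordinates (Re v, Im v), as row vectors because this is what
   [jacobian] expects. *)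
Definition to_rect v : 'rV[R]_(N + N) :=
  row_mx (map_mx (@complex.Re R) v)^T (map_mx (@complex.Im R) v)^T.

Definition of_rect (x : 'rV[R]_(N + N)) : 'cV[R[i]]_N :=
  \col_k Complex (lsubmx x 0 k) (rsubmx x 0 k).

(* [jacobian] represents the differential acting on row vectors on the right;
   the transpose is the usual matrix, with entry (i, j) the derivative of the
   i-th component along the j-th coordinate. *)
Definition load_flow_jacobian Y (v0 : R[i]) v : 'M[R]_(N + N) :=
  (jacobian (to_rect \o load_flow Y v0 \o of_rect) (to_rect v))^T.

Definition non_singular Y (v0 : R[i]) (V : set 'cV[R[i]]_N) : Prop :=
  forall v, V v -> load_flow_jacobian Y v0 v \in unitmx.

End LoadFlow.

(* Main.v *)
(** In rectangular coordinates the load-flow map has the form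
    [f x = B x (x - c)] with [B] real-bilinear, so that
    [f (x + h) = f x + d h + B h h] exactly, [d] being the differential of [f]
    at [x].  Where [d] is invertible, [f (x + h) = y] is a fixed-point equation
    for [h] to which Banach's theorem applies near [0], so [f] maps
    neighbourhoods of [x] to neighbourhoods of [f x].  Hence [F @` V] is open.
    As [closure V] is compact, [F @` closure V] is closed; the two sets have the
    same trace on [S], which is therefore clopen in [S] and nonempty. *)

Require Import Defs.
From HB Require Import structures.
From mathcomp Require Import all_boot all_order all_algebra.
From mathcomp Require Import lra complex.
From mathcomp Require Import all_classical all_reals all_analysis.

Import Order.TTheory GRing.Theory Num.Theory.
Import numFieldNormedType.Exports.

Local Open Scope classical_set_scope.
Local Open Scope ring_scope.

Set Implicit Arguments.
Unset Strict Implicit.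
Unset Printing Implicit Defensive.

(** * Norm bounds, and local solvability of [h + B h h = y] *)

Lemma ler_mx_norm_coord (K : numDomainType) m n (x : 'M[K]_(m, n)) i j :
  `|x i j| <= `|x|.
Proof.
rewrite [leRHS]/Num.Def.normr/= mx_normE.
exact: (le_bigmax (0%:nng : {nonneg K}) (fun k => `|x k.1 k.2|%:nng) (i, j)).
Qed.

(** Expand [x] on the canonical basis: each coordinate is at most the sup norm. *)
Lemma rV_linear_bounded (R : realType) n (W : normedModType R)
    (L : {linear 'rV[R]_n -> W}) (x : 'rV[R]_n) :
  `|L x| <= (\sum_j `|L 'e_j|) * `|x|.
Proof.
rewrite {1}[x]row_sum_delta linear_sum mulr_suml.
apply: le_trans (ler_norm_sum _ _ _) _; apply: ler_sum => j _.
by rewrite linearZ normrZ mulrC ler_wpM2l// ler_mx_norm_coord.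
Qed.

Lemma rV_bilinear_bounded (R : realType) m n (W : normedModType R)
    (B : {bilinear 'rV[R]_m -> 'rV[R]_n -> W}) (x : 'rV[R]_m) (y : 'rV[R]_n) :
  `|B x y| <= (\sum_i \sum_j `|B 'e_i 'e_j|) * `|x| * `|y|.
Proof.
have /= := rV_linear_bounded (applyr B y) x; move/le_trans; apply.
rewrite mulrAC ler_wpM2r// mulr_suml ler_sum// => i _.
exact: rV_linear_bounded (B 'e_i) y.
Qed.

Lemma rV_linear_continuous (R : realType) n (W : normedModType R)
    (L : {linear 'rV[R]_n -> W}) : continuous L.
Proof.
apply/linear_bounded_continuous/bounded_funP => r.
exists ((\sum_j `|L 'e_j|) * r) => x xr.
apply: le_trans (rV_linear_bounded L x) _.
by rewrite ler_wpM2l// sumr_ge0.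
Qed.

(** Solutions are the fixed points of [h |-> y - B h h], which contracts a small enough closed ball
    around 0. *)
Lemma add_bilinear_small_surj (R : realType) (X : completeNormedModType R)
    (B : {bilinear X -> X -> X}) (k : R) :
  (forall u v, `|B u v| <= k * `|u| * `|v|) ->
  forall e, 0 < e -> exists2 d, 0 < d &
    forall y, `|y| < d -> exists2 h, `|h| < e & h + B h h = y.
Proof.
move=> Bk e e0.
pose K := Num.max k 0.
have K0 : 0 <= K by rewrite le_max lexx orbT.
have BK u v : `|B u v| <= K * `|u| * `|v|.
  by apply: le_trans (Bk u v) _; rewrite !ler_wpM2r// le_max lexx.
(* [4 * K * r <= 1] yields both [K * r * r <= r / 4] and the Lipschitz constant
   [2 * K * r <= 1 / 2]. The [+ 1] in the witness covers [K = 0]. *)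
have [r r0 [re rK]] : exists2 r, 0 < r & r < e /\ 4 * K * r <= 1.
  exists (Num.min (e / 2) (4 * K + 1)^-1).
    rewrite lt_min invr_gt0; apply/andP; split; lra.
  split; first by rewrite gt_min; apply/orP; left; lra.
  apply: (@le_trans _ _ ((4 * K + 1) * (4 * K + 1)^-1)).
    apply: ler_pM; [lra| |lra|by rewrite ge_min lexx orbT].
    rewrite le_min invr_ge0; apply/andP; split; lra.
  by rewrite mulfV//; lra.
(* Since [B h h] has norm at most [r / 4] on the ball, [r / 2 + r / 4 <= r] keeps [T h] inside
   it. *)
exists (r / 2); first lra.
move=> y yr.
pose U := [set h : X | `|h| <= r].
pose T h := y - B h h.
have TU : {homo T : h / U h}.
  move=> h hr; rewrite /U/= /T.
  apply: le_trans (ler_normB _ _) _.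
  have := BK h h; have hr' : `|h| <= r := hr.
  have : K * `|h| * `|h| <= K * r * r by rewrite -!mulrA ler_wpM2l// ler_pM.
  have : K * r * r <= r / 4.
    by rewrite [leRHS]mulrC ler_wpM2r//; lra.
  lra.
have half0 : 0 <= 2^-1 :> R by [].
have ctr : is_contraction (mkfun TU).
  exists (NngNum half0); split => /=; first lra.
  move=> [u v] /= [ur vr]; rewrite /T opprB addrC subrKA.
  (* Each term now has one factor [v - u] and another of norm at most [r]. *)
  have -> : B v v - B u u = B (v - u) v + B u (v - u).
    by rewrite linearBl linearBr addrA subrK.
  rewrite distrC; apply: le_trans (ler_normD _ _) _.
  apply: (@le_trans _ _ (K * `|v - u| * r + K * r * `|v - u|)).
    apply: lerD.
      by apply: le_trans (BK _ _) _; rewrite ler_wpM2l// mulr_ge0.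
    by apply: le_trans (BK _ _) _; rewrite ler_wpM2r// ler_wpM2l.
  by rewrite [_ * r]mulrAC -mulrDl ler_wpM2r//; lra.
have Ucl : closed U.
  rewrite (_ : U = (fun h : X => `|h|) @^-1` [set t | t <= r])//.
  by apply: closed_comp => [h _|]; [exact: norm_continuous|exact: closed_le].
have [h Uh hT] : exists2 h, U h & h = T h.
  apply: (banach_fixed_point ctr) => //.
  by exists 0; rewrite /U/= normr0 ltW.
exists h; first exact: le_lt_trans Uh re.
by rewrite {1}hT /T subrK.
Qed.

(** * Quadratic maps of the form [x |-> B x (x - c)] *)

Section quadratic_map.
Variables (R : realType) (n : nat).
Variable (B : {bilinear 'rV[R]_n -> 'rV[R]_n -> 'rV[R]_n}) (c : 'rV[R]_n).
Let f (x : 'rV[R]_n) : 'rV[R]_n := B x (x - c).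
Let d (x h : 'rV[R]_n) : 'rV[R]_n := B h (x - c) + B x h.

Lemma quadratic_map_shift x h : f (h + x) = f x + d x h + B h h.
Proof.
by rewrite /f /d linearDl -addrA !linearDr (AC (2*2) (4*(2*3)*1)).
Qed.

Lemma quadratic_map_dlinear x : linear (d x).
Proof. by move=> a u v; rewrite /d linearPl linearPr scalerDr addrACA. Qed.

(** The remainder [B h h] is quadratic in [h], hence negligible at first order. *)
Lemma quadratic_map_differentiable x :
  differentiable f x /\ 'd f x = d x :> ('rV[R]_n -> 'rV[R]_n).
Proof.
pose dL : {linear 'rV[R]_n -> 'rV[R]_n} :=
  HB.pack (d x) (GRing.isLinear.Build _ _ _ _ _ (quadratic_map_dlinear x)).
have dc : continuous dL by exact: rV_linear_continuous.
have df : f \o shift x = cst (f x) + dL +o_ 0 id.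
  apply/eqaddoP => e e0.
  pose k := \sum_i \sum_j `|B 'e_i 'e_j|.
  have k0 : 0 <= k by do 2![apply: sumr_ge0 => ? _].
  (* On this ball [(k + 1) * |h| <= e]; the [+ 1] keeps the denominator positive. *)
  have hk0 : \forall h \near (0 : 'rV[R]_n), `|h| <= e / (k + 1).
    by apply: nbhs0_le; apply: divr_gt0 => //; lra.
  near=> h.
  have -> : (f \o shift x - (cst (f x) + dL)) h = B h h.
    rewrite -[LHS]/(f (h + x) - (f x + d x h)) quadratic_map_shift.
    by rewrite addrC addKr.
  apply: le_trans (rV_bilinear_bounded B h h) _.
  rewrite ler_wpM2r// -/k.
  have hk : `|h| <= e / (k + 1) by near: h; exact: hk0.
  apply: le_trans (_ : (k + 1) * `|h| <= _); first by rewrite ler_wpM2r//; lra.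
  by rewrite mulrC -ler_pdivlMr//; lra.
have dE : 'd f x = dL :> (_ -> _) by exact: diff_unique.
by split=> //; apply/diff_locallyP; rewrite dE.
Unshelve. all: by end_near. Qed.

Lemma quadratic_map_continuous : continuous f.
Proof.
move=> x; apply: differentiable_continuous.
by have [] := quadratic_map_differentiable x.
Qed.

(** Multiplying [f (h + x) = y] on the right by [invmx J] gives [h + C h h = (y - f x) *m invmx J],
    where [C u v = B u v *m invmx J]; this is solvable with small [h] once the right-hand side is
    small. *)
Lemma quadratic_map_open x U : jacobian f x \in unitmx ->
  nbhs x U -> nbhs (f x) (f @` U).
Proof.
set J := jacobian f x => Junit /nbhs_ballP[e /= e0 eU].
have dJ h : d x h = h *m J.
  have [_ dE] := quadratic_map_differentiable x.
  by rewrite -dE mul_rV_lin1.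
pose X : completeNormedModType R := HB.pack 'rV[R]_n.
pose C u v : 'rV[R]_n := B u v *m invmx J.
have Cbil : bilinear_for (GRing.Scale.Law.clone _ _ *:%R _)
    (GRing.Scale.Law.clone _ _ *:%R _) C.
  split=> [v|u] a y z; rewrite /C /=.
    by rewrite linearPl mulmxDl -scalemxAl.
  by rewrite linearPr mulmxDl -scalemxAl.
pose CX : {bilinear X -> X -> X} :=
  HB.pack C (bilinear_isBilinear.Build R X X X _ _ C Cbil).
have Cbound u v : `|CX u v| <= (\sum_i \sum_j `|CX 'e_i 'e_j|) * `|u| * `|v|.
  exact: (@rV_bilinear_bounded R n n _ CX).
have [r r0 Hr] := add_bilinear_small_surj Cbound e0.
(* The right-hand side is continuous in [y] and vanishes at [f x]. *)
have : nbhs (f x) [set y | `|(y - f x) *m invmx J| < r].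
  have cc : continuous (fun y : 'rV[R]_n => (y - f x) *m invmx J).
    move=> y; apply: (@cvg_comp _ _ _ (fun y => y - f x) (mulmxr (invmx J))
      _ (nbhs (y - f x))).
      apply: (@cvgB R 'rV[R]_n _ (nbhs y) _ id (fun=> f x)).
        exact: cvg_id.
      exact: cvg_cst.
    exact: (@rV_linear_continuous R n _ (mulmxr (invmx J))).
  have := cvgr_norm_lt _ (cc (f x)); apply.
  by rewrite subrr mul0mx normr0.
apply: filterS => y /= /Hr[h hr hE].
exists (h + x).
  by apply: eU; rewrite -ball_normE /ball_/= opprD addrC subrK normrN.
rewrite quadratic_map_shift dJ -addrA.
have -> : h *m J + B h h = y - f x.
  have : (h + C h h) *m J = (y - f x) by rewrite hE mulmxKV.
  by rewrite mulmxDl mulmxKV.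
by rewrite addrC subrK.
Qed.

End quadratic_map.

(** * Rectangular coordinates *)

Local Notation "x %:C" := (real_complex _ x) (format "x %:C") : ring_scope.

Lemma to_rectK (R : realType) N : cancel (@to_rect R N) (@of_rect R N).
Proof.
move=> v; apply/colP => k; rewrite mxE row_mxKl row_mxKr !mxE.
by case: (v k 0).
Qed.

Lemma of_rectK (R : realType) N : cancel (@of_rect R N) (@to_rect R N).
Proof.
move=> x; rewrite -[RHS]hsubmxK; congr row_mx; apply/rowP => k;
  by rewrite !mxE.
Qed.

(** The two sides are modules over different scalars, so real linearity is spelled out through
    [%:C]. *)
Lemma of_rectP (R : realType) N (a : R) (x y : 'rV[R]_(N + N)) :
  of_rect (a *: x + y) = a%:C *: of_rect x + of_rect y.
Proof.
apply/colP => k; apply/eqP; rewrite eq_complex !mxE/=.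
by rewrite !mul0r subr0 addr0 !eqxx.
Qed.

Lemma to_rectP (R : realType) N (a : R) (u v : 'cV[R[i]]_N) :
  to_rect (a%:C *: u + v) = a *: to_rect u + to_rect v.
Proof. by rewrite -[u]to_rectK -[v]to_rectK -of_rectP !of_rectK. Qed.

Lemma conj_mxP (R : realType) m n (a : R) (u v : 'M[R[i]]_(m, n)) :
  conj_mx (a%:C *: u + v) = a%:C *: conj_mx u + conj_mx v.
Proof.
apply/matrixP => i j; rewrite !mxE rmorphD rmorphM/=; congr (_ * _ + _).
exact: conjc_real.
Qed.

(** Multiplication by [i] preserves the modulus and turns the imaginary part, up to sign, into the
    real part. *)
Lemma ge_normc_Im (R : realType) (z : R[i]) : `|complex.Im z|%:C <= `|z|.
Proof.
rewrite -normrN -ReiNIm (le_trans (normc_ge_Re _))//.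
by rewrite normrM complexiE normCi mulr1.
Qed.

Lemma le_normc_ReIm (R : realType) (z : R[i]) :
  `|z| <= (`|complex.Re z| + `|complex.Im z|)%:C.
Proof.
have nR (a : R) : `|a%:C| = `|a|%:C.
  by rewrite normc_def/= expr0n/= addr0 sqrtr_sqr.
rewrite [in leLHS](complexE z) (le_trans (ler_normD _ _))//.
by rewrite normrM !nR complexiE normCi mul1r rmorphD.
Qed.

Lemma of_rect_continuous (R : realType) N : continuous (@of_rect R N).
Proof.
move=> x U /nbhs_ballP[e /= e0 eU]; apply/nbhs_ballP.
(* The radius [e] lives in [R[i]], where being positive forces it to be real. *)
have e1 : 0 < complex.Re e by move: e0; rewrite ltcE => /andP[].
have eE : e = (complex.Re e)%:C.
  by move: e0; rewrite ltcE => /andP[/eqP + _]; case: (e) => a b /= ->.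
exists (complex.Re e / 2) => /=; first by rewrite divr_gt0.
move=> y [_ xy]; apply: eU; split => // i j.
rewrite -ball_normE /ball_/= !mxE.
apply: le_lt_trans (le_normc_ReIm _) _; rewrite eE ltcR/= [ltRHS]splitr.
have h k := xy 0 k; rewrite -ball_normE /ball_/= in h.
by apply: ltrD; [move: (h (lshift N i))|move: (h (rshift N i))].
Qed.

Lemma to_rect_continuous (R : realType) N : continuous (@to_rect R N).
Proof.
have ReB (x y : R[i]) : complex.Re x - complex.Re y = complex.Re (x - y).
  by case: x y => [? ?] [].
have ImB (x y : R[i]) : complex.Im x - complex.Im y = complex.Im (x - y).
  by case: x y => [? ?] [].
move=> v U /nbhs_ballP[e /= e0 eU]; apply/nbhs_ballP.
exists e%:C => /=; first by rewrite ltcR.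
move=> w [_ vw]; apply: eU; split => // i j.
have h k := vw k i; rewrite -ball_normE /ball_/= in h.
rewrite -ball_normE /ball_/=; rewrite /to_rect !mxE.
case: splitP => k _; rewrite !mxE -ltcR; apply: le_lt_trans (h k).
  by rewrite ReB; exact: normc_ge_Re.
by rewrite ImB; exact: ge_normc_Im.
Qed.

(** [V] lies in the image under [of_rect] of a real box, which is compact. *)
Lemma cV_bounded_closure_compact (R : realType) N (V : set 'cV[R[i]]_N) :
  bounded_set V -> compact (closure V).
Proof.
move=> [M [_ VM]].
have M1 : M < M + 1 by rewrite ltrDl.
(* [M] is an element of [R[i]]; comparing a real number with [M + 1] there amounts, for the bound,
   to comparing it with [r]. *)
pose r := complex.Re (M + 1).
pose D := [set x : 'rV[R]_(N + N) | forall k, x 0 k \in `[- r, r]].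
have Dc : compact D.
  apply: (@rV_compact _ _ (fun=> `[- r, r]%classic)) => _.
  exact: segment_compact.
have rDc : compact (@of_rect R N @` D).
  apply: continuous_compact Dc.
  exact/continuous_subspaceT/of_rect_continuous.
apply: (subclosed_compact (@closed_closure _ V) rDc).
(* The compact image is closed, so it suffices to enclose [V] itself. *)
rewrite [X in _ `<=` X](closure_id _).1; last first.
  exact: compact_closed (@norm_hausdorff _ _) rDc.
apply: closureS => v Vv; exists (to_rect v); last exact: to_rectK.
move=> k; rewrite in_itv/= -ler_norml -lecR.
have vM i : `|v i 0| <= M + 1.
  exact: le_trans (ler_mx_norm_coord _ _ _) (VM _ M1 _ Vv).
have le_r (z : R) i : `|z|%:C <= `|v i 0| -> `|z|%:C <= r%:C.
  move=> /le_trans/(_ (vM i)); rewrite lecE => /andP[_].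
  by rewrite lecR.
rewrite /to_rect mxE; case: splitP => i _; rewrite !mxE; apply: (le_r _ i).
  exact: normc_ge_Re.
exact: ge_normc_Im.
Qed.

(** * The load-flow map *)

Section load_flow_map.
Variables (R : realType) (N : nat) (Y : 'M[R[i]]_(1 + N)) (v0 : R[i]).

(** Conjugation makes the complex form antilinear in its second argument; over the reals it is
    bilinear. *)
Definition rect_form (x y : 'rV[R]_(N + N)) : 'rV[R]_(N + N) :=
  to_rect (diag_mx (of_rect x)^T *m conj_mx (drsubmx Y) *m conj_mx (of_rect y)).

Lemma rect_form_is_bilinear :
  bilinear_for (GRing.Scale.Law.clone _ _ *:%R _)
    (GRing.Scale.Law.clone _ _ *:%R _) rect_form.
Proof.
split=> [y|x] a u v; rewrite /rect_form /=.
  by rewrite of_rectP !linearP/= !mulmxDl -!scalemxAl to_rectP.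
by rewrite of_rectP conj_mxP mulmxDr -scalemxAr to_rectP.
Qed.

HB.instance Definition _ :=
  bilinear_isBilinear.Build R _ _ _ _ _ rect_form rect_form_is_bilinear.

Lemma load_flow_rectE :
  @to_rect R N \o load_flow Y v0 \o @of_rect R N =
  fun x => rect_form x (x - to_rect (zero_load_voltage Y v0)).
Proof.
apply/funext => x; rewrite /= /rect_form /load_flow; congr (to_rect (_ *m _)).
rewrite [x - _]addrC -[- to_rect _]scaleN1r of_rectP to_rectK conj_mxP.
by rewrite rmorphN1 scaleN1r addrC.
Qed.

Lemma load_flowE v :
  load_flow Y v0 v =
  of_rect ((@to_rect R N \o load_flow Y v0 \o @of_rect R N) (to_rect v)).
Proof. by rewrite /= !to_rectK. Qed.

Lemma load_flow_continuous : continuous (load_flow Y v0).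
Proof.
rewrite (funext load_flowE) => v.
apply: (@continuous_comp _ _ _ (fun v =>
  (@to_rect R N \o load_flow Y v0 \o @of_rect R N) (to_rect v))); last first.
  exact: of_rect_continuous.
apply: continuous_comp; first exact: to_rect_continuous.
rewrite load_flow_rectE; exact: quadratic_map_continuous.
Qed.

Lemma load_flow_image_open V : open V -> non_singular Y v0 V ->
  open (load_flow Y v0 @` V).
Proof.
move=> Vo Vns; rewrite openE => _ [v Vv <-].
have nV : nbhs (to_rect v) (@of_rect R N @^-1` V).
  by apply: of_rect_continuous; rewrite to_rectK; exact: open_nbhs_nbhs.
set f := @to_rect R N \o load_flow Y v0 \o @of_rect R N.
have : nbhs (f (to_rect v)) (f @` (@of_rect R N @^-1` V)).
  (* Transposition does not affect invertibility, so the hypothesis applies to [jacobian]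
     directly. *)
  have := Vns v Vv; rewrite /load_flow_jacobian unitmx_tr /f load_flow_rectE.
  by move=> Ju; exact: quadratic_map_open.
(* Continuity of [to_rect] pulls the neighbourhood back to complex coordinates. *)
rewrite /f/= to_rectK => /to_rect_continuous; rewrite nbhs_simpl/=.
apply: filterS => s [x Vx] /(congr1 (@of_rect R N)).
by rewrite /= !to_rectK => <-; exists (of_rect x).
Qed.

End load_flow_map.

Unset Implicit Arguments.

(** * The connectedness argument *)

Theorem theorem3 (R : realType) (N : nat)
    (Y : 'M[R[i]]_(1 + N)) (v0 : R[i])
    (YLL_unit : drsubmx Y \in unitmx)
    (V S : set 'cV[R[i]]_N)
    (V_bounded : bounded_set V)
    (V_open : open V)
    (V_nonsing : non_singular Y v0 V)
    (S_conn : connected S)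
    (FV_S : (load_flow Y v0 @` V) `&` S !=set0)
    (FdV_S : (load_flow Y v0 @` boundary V) `&` S = set0) :
  forall s : 'cV[R[i]]_N, S s ->
    exists v : 'cV[R[i]]_N, V v /\ load_flow Y v0 v = s.
Proof.
set F := load_flow Y v0.
have Ko : open (F @` V) by exact: load_flow_image_open.
have Kc : closed (F @` closure V).
  apply: compact_closed (@norm_hausdorff _ _) _.
  apply: continuous_compact (cV_bounded_closure_compact V_bounded).
  exact/continuous_subspaceT/load_flow_continuous.
have SE : S `&` (F @` V) = S `&` (F @` closure V).
  apply/seteqP; split=> [s [Ss [v Vv vs]]|s [Ss [v Vv vs]]].
    by split => //; exists v => //; exact: subset_closure.
  (* A point of [closure V] outside [V] is in [boundary V], whose image misses [S]. *)
  split => //; exists v => //; apply: contrapT => nVv.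
  have : (F @` boundary V `&` S) s.
    split => //; exists v => //; split => // /interior_subset; exact: nVv.
  by rewrite FdV_S.
(* [SE] presents one nonempty subset of [S] as both relatively open and relatively closed. *)
have SV : S `&` (F @` V) = S.
  apply: S_conn; first by rewrite setIC.
    by exists (F @` V).
  by exists (F @` closure V).
by move=> s; rewrite -SV => -[_ [v Vv vs]]; exists v.
Qed.
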